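(* Assume that $\mathcal J$ (the solution of the equilibrium PDE described in the context, with the equilibrium control $\alpha^\star$ given there) has the quadratic form $$\mathcal J(t,x,y)=A(t)x^2+B(t)y^2+C(t)xy+D(t)x+F(t)y+H(t),\quad (t,x,y)\in[0,T]\times\mathbb R\times\mathbb R.$$ Then the equilibrium control is linear in $x$: $$\alpha^\star(t,x)=-\bar b\,(2A(t)+C(t))\,x,$$ and the time-dependent coefficients satisfy $$A'+2\bar aA-2\bar b^2A(2A+C)+\tfrac12\bar b^2(2A+C)^2=0,\quad A(T)=\Gamma/2,$$ $$C'+\bar aC-\bar b^2C(2A+C)=0,\quad C(T)=-\Gamma,$$ $$H'-\tfrac12\bar b^2D^2+\sigma^2A=0,\quad H(T)=0,$$ with $B(t)\equiv\Gamma/2$, $D(t)\equiv0$ and $F(t)\equiv0$.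
   Context: Linear–quadratic problem in dimension one: $T>0$, constants $\bar a,\bar b,\Gamma\in\mathbb R$, $\sigma\neq0$. The state satisfies $\mathrm dX_t=(\bar aX_t+\bar b\alpha_t)\mathrm dt+\sigma\,\mathrm dW_t$, $X_0=x_0$, and the cost (to be minimised) is $J(t,x,\alpha)=\mathbb E^{\mathbb P^{t,x,\alpha}}[\int_t^T\frac12\alpha_s^2\mathrm ds+\frac\Gamma2(X_T-x)^2]$, where $\mathbb P^{t,x,\alpha}$ is the law under which $X$ is controlled by $\alpha$ and starts from $x$ at time $t$. Controls take values in $\mathbb R$. In the equilibrium characterisation, $\mathcal J(t,x,y)$ is the cost from $(t,x)$ under the equilibrium control with terminal cost $\frac\Gamma2(X_T-y)^2$ ($y$ frozen), and $V(t,x)=\mathcal J(t,x,x)$. The equilibrium feedback is the minimiser of the extended Hamiltonian, namely $$\alpha^\star(t,x)=\bar b\big(\partial_y\mathcal J(t,x,y)|_{y=x}-\partial_xV(t,x)\big),$$ and $\mathcal J$ solves $$\partial_t\mathcal J+(\bar ax+\bar b\alpha^\star(t,x))\partial_x\mathcal J+\tfrac12\sigma^2\partial_{xx}\mathcal J+\tfrac12(\alpha^\star(t,x))^2=0,\quad\mathcal J(T,x,y)=\tfrac\Gamma2(x-y)^2,$$ for all $(t,x,y)$. The coefficients $A,\dots,H$ are differentiable functions of $t$. *)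

(* Defs.v *)
From Stdlib Require Import Reals.
From Coquelicot Require Import Coquelicot.
Open Scope R_scope.

Definition time_domain (T t : R) : Prop := 0 <= t <= T.

(* Derivatives in time are taken within [0, T], hence one-sided at t = 0 and
   t = T; values outside [0, T] play no role. *)
Definition time_derivative (T : R) (f f' : R -> R) : Prop :=
  forall t, time_domain T t -> D_in f f' (time_domain T) t.

Definition value (J : R -> R -> R -> R) (t x : R) : R := J t x x.

Definition eq_control (b : R) (J : R -> R -> R -> R) (t x : R) : R :=
  b * (Derive (fun y => J t x y) x - Derive (fun z => value J t z) x).

(* [Derive] and [Derive_n] are total, so the existence of the spatial
   derivatives occurring in the equation and in [eq_control] is stated
   separately. *)
Definition spatially_smooth (T : R) (J : R -> R -> R -> R) : Prop :=
  forall t x y, time_domain T t ->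
    ex_derive_n (fun z => J t z y) 2 x /\
    ex_derive (fun z => J t z y) x /\
    ex_derive (fun z => J t x z) y /\
    ex_derive (fun z => value J t z) x.

Definition solves_equilibrium_PDE (T a b Gamma sigma : R)
    (J : R -> R -> R -> R) : Prop :=
  spatially_smooth T J /\
  (exists dtJ : R -> R -> R -> R,
     (forall x y,
        time_derivative T (fun t => J t x y) (fun t => dtJ t x y)) /\
     (forall t x y, time_domain T t ->
        dtJ t x y
        + (a * x + b * eq_control b J t x) * Derive (fun z => J t z y) x
        + / 2 * sigma ^ 2 * Derive_n (fun z => J t z y) 2 x
        + / 2 * (eq_control b J t x) ^ 2 = 0)) /\
  (forall x y, J T x y = Gamma / 2 * (x - y) ^ 2).

(* Main.v *)
Require Import Defs.
From Stdlib Require Import Reals Lra.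
From Coquelicot Require Import Coquelicot.
Open Scope R_scope.

(** For quadratic [J] the equilibrium control is affine in [x]: with
    [k = 2 * A + C],
      [eq_control b J t x = - b * (k t * x + D t)].
    For each [t] the equilibrium equation then says that a quadratic polynomial
    in [(x, y)] vanishes identically, so each of its six coefficients does.  The
    coefficients of [x ^ 2], [x * y] and [1] are the equations claimed for [A],
    [C] and [H].  The other three are
      [B' = 0],  [D' = (2 * b ^ 2 * A - a) * D],  [F' = b ^ 2 * C * D];
    the terms [b ^ 2 * k * D] produced by the drift and by the running cost
    cancel in the second one, which is therefore linear homogeneous in [D].
    The terminal condition gives [D T = 0], so [D] vanishes by backward
    uniqueness ([linear_ode_backward_unique]); hence [F' = 0], and [B] and [F]
    keep their terminal values.  Vanishing of [D] also removes the constant term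
    of the control.

    Time derivatives are relative to [[0, T]], so the mean value theorem is
    applied to the extension of a function that is constant outside
    [[0, T]] ([clamp]). *)

(** * Calculus relative to a compact interval *)

Definition clamp (T t : R) : R := Rmax 0 (Rmin t T).

Lemma clamp_in_domain (T t : R) : 0 <= T -> time_domain T (clamp T t).
Proof.
  intros HT; unfold clamp, time_domain, Rmax, Rmin.
  repeat destruct Rle_dec; lra.
Qed.

Lemma clamp_id (T t : R) : time_domain T t -> clamp T t = t.
Proof.
  unfold clamp, time_domain, Rmax, Rmin; intros Ht.
  repeat destruct Rle_dec; lra.
Qed.

Lemma clamp_nonexpansive (T s t : R) :
  Rabs (clamp T s - clamp T t) <= Rabs (s - t).
Proof.
  unfold clamp, Rmax, Rmin, Rabs.
  repeat destruct Rle_dec; repeat destruct Rcase_abs; lra.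
Qed.

Lemma continuity_pt_clamp (T : R) (f f' : R -> R) (t : R) :
  0 <= T -> time_derivative T f f' ->
  continuity_pt (fun s => f (clamp T s)) t.
Proof.
  intros HT Hf eps Heps.
  pose proof (cont_deriv _ _ _ _ (Hf _ (clamp_in_domain T t HT))) as Hcont.
  destruct (Hcont eps Heps) as [delta [Hdelta Hclose]].
  exists delta; split; [exact Hdelta|].
  intros s [_ Hs]; cbn in *; unfold Rdist in *.
  destruct (Req_dec (clamp T s) (clamp T t)) as [E | NE].
  - rewrite E, Rminus_diag, Rabs_R0; lra.
  - apply Hclose; split.
    + split; [apply clamp_in_domain, HT | intros E; apply NE; now symmetry].
    + pose proof (clamp_nonexpansive T s t); lra.
Qed.

Lemma time_derivative_interior (T : R) (f f' : R -> R) (t : R) :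
  time_derivative T f f' -> 0 < t < T -> is_derive f t (f' t).
Proof.
  intros Hf Ht; apply is_derive_Reals, derivable_pt_lim_D_in.
  intros eps Heps.
  assert (Hdom : time_domain T t) by (unfold time_domain; lra).
  destruct (Hf t Hdom eps Heps) as [delta [Hdelta Hclose]].
  exists (Rmin delta (Rmin t (T - t))); split.
  - repeat apply Rmin_glb_lt; lra.
  - cbn in *; unfold Rdist in *; intros s [[_ Hne] Hs].
    pose proof (Rmin_l delta (Rmin t (T - t))).
    pose proof (Rmin_r delta (Rmin t (T - t))).
    pose proof (Rmin_l t (T - t)).
    pose proof (Rmin_r t (T - t)).
    apply Hclose; split; [split; [|exact Hne] | lra].
    assert (Hlt : Rabs (s - t) < Rmin t (T - t)) by lra.
    apply Rabs_def2 in Hlt; unfold time_domain; lra.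
Qed.

Lemma time_derivative_nonneg_le_final (T : R) (f f' : R -> R) :
  time_derivative T f f' -> (forall t, time_domain T t -> 0 <= f' t) ->
  forall t, time_domain T t -> f t <= f T.
Proof.
  intros Hf Hpos t Ht.
  assert (HT : 0 <= T) by (unfold time_domain in Ht; lra).
  (* The derivative is evaluated at clamped times because the mean value theorem
     may return an end point of the interval. *)
  destruct (MVT_gen (fun s => f (clamp T s)) t T (fun s => f' (clamp T s)))
    as [c [_ Heq]].
  - rewrite Rmin_left, Rmax_right by (unfold time_domain in Ht; lra).
    intros s Hs; unfold time_domain in Ht.
    rewrite clamp_id by (unfold time_domain; lra).
    apply (is_derive_ext_loc f).
    + apply (locally_interval _ s 0 T); simpl; [lra | lra |].
      intros u H0 H1; rewrite clamp_id; [reflexivity | unfold time_domain; lra].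
    + apply (time_derivative_interior T f f' s Hf); lra.
  - intros s _; now apply (continuity_pt_clamp T f f').
  - rewrite !clamp_id in Heq by (unfold time_domain in *; lra).
    assert (0 <= f' (clamp T c) * (T - t)); [|lra].
    apply Rmult_le_pos; [apply Hpos, clamp_in_domain, HT |].
    unfold time_domain in Ht; lra.
Qed.

Lemma time_derivative_bounded_below (T : R) (f f' : R -> R) :
  0 <= T -> time_derivative T f f' ->
  exists m, forall t, time_domain T t -> m <= f t.
Proof.
  intros HT Hf.
  destruct (continuity_ab_min (fun s => f (clamp T s)) 0 T HT) as [s [Hs _]].
  - intros c _; now apply (continuity_pt_clamp T f f').
  - exists (f (clamp T s)); intros t Ht.
    rewrite <- (clamp_id T t Ht) at 1; apply Hs; exact Ht.
Qed.

Lemma time_derivative_of_is_derive (T : R) (f f' : R -> R) :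
  (forall t, is_derive f t (f' t)) -> time_derivative T f f'.
Proof.
  intros Hf t _.
  apply (limit1_imp _ (D_x no_cond t)).
  - intros s [_ Hs]; split; [exact I | exact Hs].
  - apply derivable_pt_lim_D_in, is_derive_Reals, Hf.
Qed.

(** A Gronwall argument: if [m] bounds [c] from below then
    [f t ^ 2 * exp (- 2 * m * t)] is nonnegative, and nondecreasing because its
    derivative is [2 * (c t - m) * f t ^ 2 * exp (- 2 * m * t)]; so it is squeezed
    between [0] and its final value [0]. *)
Lemma linear_ode_backward_unique (T m : R) (c f f' : R -> R) :
  time_derivative T f f' ->
  (forall t, time_domain T t -> f' t = c t * f t) ->
  (forall t, time_domain T t -> m <= c t) ->
  f T = 0 ->
  forall t, time_domain T t -> f t = 0.
Proof.
  intros Hf Hode Hm HfT t Ht.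
  set (w := fun s => exp (- 2 * m * s)).
  assert (Hw : time_derivative T w (fun s => - 2 * m * w s)).
  { apply time_derivative_of_is_derive; intros s; unfold w.
    auto_derive; [exact I | ring]. }
  assert (Hle : f t * f t * w t <= f T * f T * w T).
  { apply (time_derivative_nonneg_le_final T (fun s => f s * f s * w s)
      (fun s => (f' s * f s + f s * f' s) * w s + f s * f s * (- 2 * m * w s)));
      [| | exact Ht].
    - intros s Hs.
      exact (Dmult _ _ _ _ _ _ (Dmult _ _ _ _ _ _ (Hf s Hs) (Hf s Hs)) (Hw s Hs)).
    - intros s Hs; rewrite (Hode s Hs).
      replace (_ + _) with (2 * (c s - m) * (f s * f s) * w s) by ring.
      pose proof (Hm s Hs).
      apply Rmult_le_pos; [apply Rmult_le_pos |].
      + lra.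
      + apply Rle_0_sqr.
      + apply Rlt_le, exp_pos. }
  rewrite HfT in Hle.
  pose proof (exp_pos (- 2 * m * t)) as Hpos; fold (w t) in Hpos.
  pose proof (Rle_0_sqr (f t)) as Hsqr; unfold Rsqr in Hsqr.
  assert (f t * f t = 0) as H0 by nra.
  destruct (Rmult_integral _ _ H0); assumption.
Qed.

Lemma zero_time_derivative_constant (T k : R) (f f' : R -> R) :
  time_derivative T f f' ->
  (forall t, time_domain T t -> f' t = 0) ->
  f T = k ->
  forall t, time_domain T t -> f t = k.
Proof.
  intros Hf Hzero HfT t Ht.
  apply Rminus_diag_uniq.
  apply (linear_ode_backward_unique T 0 (fun _ => 0) (fun s => f s - k)
           (fun s => f' s - 0)); [| | | | exact Ht].
  - intros s Hs; exact (Dminus _ _ _ _ _ _ (Hf s Hs) (Dconst _ k s)).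
  - intros s Hs; rewrite (Hzero s Hs); ring.
  - intros; apply Rle_refl.
  - rewrite HfT; ring.
Qed.

(** Every point of [[0, T]] is an accumulation point of it, since [0 < T]; for
    [T = 0] the relative derivative would be arbitrary. *)
Lemma time_derivative_unique (T : R) (f g f' g' : R -> R) :
  0 < T -> time_derivative T f f' -> time_derivative T g g' ->
  (forall t, time_domain T t -> f t = g t) ->
  forall t, time_domain T t -> f' t = g' t.
Proof.
  intros HT Hf Hg Hfg t Ht.
  apply (single_limit (fun s => (g s - g t) / (s - t)) (D_x (time_domain T) t)
           _ _ t).
  - intros eps Heps; unfold D_x, time_domain, Rdist in *.
    pose proof (Rmin_l (eps / 2) (T / 2)).
    pose proof (Rmin_r (eps / 2) (T / 2)).
    assert (0 < Rmin (eps / 2) (T / 2)) by (apply Rmin_glb_lt; lra).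
    (* Step away from [t] towards the more distant end of the interval. *)
    destruct (Rle_dec t (T / 2)).
    + exists (t + Rmin (eps / 2) (T / 2)).
      replace (_ - t) with (Rmin (eps / 2) (T / 2)) by ring.
      rewrite Rabs_pos_eq; repeat split; lra.
    + exists (t - Rmin (eps / 2) (T / 2)).
      replace (_ - t) with (- Rmin (eps / 2) (T / 2)) by ring.
      rewrite Rabs_Ropp, Rabs_pos_eq; repeat split; lra.
  - apply (limit1_ext (fun s => (f s - f t) / (s - t))); [|exact (Hf t Ht)].
    intros s [Hs _]; now rewrite (Hfg s Hs), (Hfg t Ht).
  - exact (Hg t Ht).
Qed.

Lemma time_derivative_scal_r (T k : R) (f f' : R -> R) :
  time_derivative T f f' ->
  time_derivative T (fun t => f t * k) (fun t => f' t * k).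
Proof.
  intros Hf t Ht.
  apply (limit1_ext (fun s => (k * f s - k * f t) / (s - t))).
  - intros s _; now rewrite !(Rmult_comm k).
  - rewrite (Rmult_comm (f' t) k).
    exact (Dmult_const _ _ _ _ k (Hf t Ht)).
Qed.

(** * Quadratic cost functionals *)

Definition quadratic (A B C D F H x y : R) : R :=
  A * x ^ 2 + B * y ^ 2 + C * x * y + D * x + F * y + H.

Lemma quadratic_eq_0 (A B C D F H : R) :
  (forall x y, quadratic A B C D F H x y = 0) ->
  A = 0 /\ B = 0 /\ C = 0 /\ D = 0 /\ F = 0 /\ H = 0.
Proof.
  unfold quadratic; intros Hq.
  pose proof (Hq 0 0); pose proof (Hq 1 0); pose proof (Hq (-1) 0).
  pose proof (Hq 0 1); pose proof (Hq 0 (-1)); pose proof (Hq 1 1).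
  repeat split; lra.
Qed.

Lemma time_derivative_quadratic (T : R) (A B C D F H A' B' C' D' F' H' : R -> R)
  (x y : R) :
  time_derivative T A A' -> time_derivative T B B' -> time_derivative T C C' ->
  time_derivative T D D' -> time_derivative T F F' -> time_derivative T H H' ->
  time_derivative T
    (fun t => quadratic (A t) (B t) (C t) (D t) (F t) (H t) x y)
    (fun t => quadratic (A' t) (B' t) (C' t) (D' t) (F' t) (H' t) x y).
Proof.
  intros hA hB hC hD hF hH t Ht.
  repeat apply Dadd; try exact (hH t Ht);
    repeat apply time_derivative_scal_r; assumption.
Qed.

Lemma is_derive_quadratic_x (J : R -> R -> R -> R) (t A B C D F H : R)
  (J_quadratic : forall x y, J t x y = quadratic A B C D F H x y) (x y : R) :
  is_derive (fun z : R => J t z y) x (2 * A * x + C * y + D).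
Proof.
  apply (is_derive_ext (fun z => quadratic A B C D F H z y)).
  - intros z; now rewrite J_quadratic.
  - unfold quadratic; auto_derive; [exact I | ring].
Qed.

Lemma Derive_n_quadratic_x (J : R -> R -> R -> R) (t A B C D F H : R)
  (J_quadratic : forall x y, J t x y = quadratic A B C D F H x y) (x y : R) :
  Derive_n (fun z => J t z y) 2 x = 2 * A.
Proof.
  simpl; rewrite (Derive_ext _ (fun z => 2 * A * z + C * y + D)).
  - apply is_derive_unique; auto_derive; [exact I | ring].
  - intros z; apply is_derive_unique.
    exact (is_derive_quadratic_x J t A B C D F H J_quadratic z y).
Qed.

(** Differentiating the value [J t x x] also moves the frozen argument, so its
    derivative at [x] is the sum of the two partial derivatives on the diagonal.
    The control is thus [- b] times the derivative in the first slot, and [B] and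
    [F] drop out. *)
Lemma eq_control_quadratic (J : R -> R -> R -> R) (t A B C D F H : R)
  (J_quadratic : forall x y, J t x y = quadratic A B C D F H x y) (b x : R) :
  eq_control b J t x = - b * ((2 * A + C) * x + D).
Proof.
  assert (Hy : is_derive (fun y : R => J t x y) x (2 * B * x + C * x + F)).
  { apply (is_derive_ext (fun y => quadratic A B C D F H x y)).
    - intros y; now rewrite J_quadratic.
    - unfold quadratic; auto_derive; [exact I | ring]. }
  assert (HV : is_derive (fun z : R => value J t z) x
                 (2 * (A + B + C) * x + (D + F))).
  { apply (is_derive_ext (fun z => quadratic A B C D F H z z)).
    - intros z; unfold value; now rewrite J_quadratic.
    - unfold quadratic; auto_derive; [exact I | ring]. }
  unfold eq_control.
  rewrite (is_derive_unique _ _ _ Hy), (is_derive_unique _ _ _ HV); ring.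
Qed.

(** * Matching coefficients in the equilibrium equation *)

(** At a fixed time the left-hand side of the equilibrium equation is a quadratic
    polynomial in [(x, y)], because uniqueness of relative derivatives identifies
    the time derivative of [J] with the quadratic in [A'], ..., [H'].  The
    equations come from the coefficients of [x ^ 2], [y ^ 2], [x * y], [x], [y]
    and [1], in this order. *)
Lemma equilibrium_coefficient_equations
  (T a b Gamma sigma : R) (J : R -> R -> R -> R)
  (A B C D F H A' B' C' D' F' H' : R -> R) :
  0 < T -> solves_equilibrium_PDE T a b Gamma sigma J ->
  time_derivative T A A' -> time_derivative T B B' -> time_derivative T C C' ->
  time_derivative T D D' -> time_derivative T F F' -> time_derivative T H H' ->
  (forall t x y, time_domain T t ->
     J t x y = quadratic (A t) (B t) (C t) (D t) (F t) (H t) x y) ->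
  forall t, time_domain T t ->
  A' t + 2 * a * A t - 2 * b ^ 2 * A t * (2 * A t + C t)
    + / 2 * b ^ 2 * (2 * A t + C t) ^ 2 = 0 /\
  B' t = 0 /\
  C' t + a * C t - b ^ 2 * C t * (2 * A t + C t) = 0 /\
  D' t - (2 * b ^ 2 * A t - a) * D t = 0 /\
  F' t - b ^ 2 * C t * D t = 0 /\
  H' t - / 2 * b ^ 2 * D t ^ 2 + sigma ^ 2 * A t = 0.
Proof.
  intros HT [_ [[dtJ [HdtJ Hpde]] _]] hA hB hC hD hF hH Hquad t Ht.
  apply quadratic_eq_0; intros x y.
  assert (Hslice : forall x y,
    J t x y = quadratic (A t) (B t) (C t) (D t) (F t) (H t) x y)
    by (intros; now apply Hquad).
  specialize (Hpde t x y Ht).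
  rewrite (eq_control_quadratic J t _ _ _ _ _ _ Hslice) in Hpde.
  rewrite (is_derive_unique _ _ _
             (is_derive_quadratic_x J t _ _ _ _ _ _ Hslice x y)) in Hpde.
  rewrite (Derive_n_quadratic_x J t _ _ _ _ _ _ Hslice) in Hpde.
  rewrite (time_derivative_unique T _ _ _ _ HT (HdtJ x y)
             (time_derivative_quadratic T _ _ _ _ _ _ _ _ _ _ _ _ x y
                hA hB hC hD hF hH)
             (fun s Hs => Hquad s x y Hs) t Ht) in Hpde.
  unfold quadratic in *; rewrite <- Hpde; field.
Qed.

Lemma terminal_coefficients (T Gamma : R) (J : R -> R -> R -> R)
  (A B C D F H : R) :
  (forall x y, J T x y = Gamma / 2 * (x - y) ^ 2) ->
  (forall x y, J T x y = quadratic A B C D F H x y) ->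
  A = Gamma / 2 /\ B = Gamma / 2 /\ C = - Gamma /\ D = 0 /\ F = 0 /\ H = 0.
Proof.
  intros Hterm Hquad.
  destruct (quadratic_eq_0 (A - Gamma / 2) (B - Gamma / 2) (C + Gamma) D F H)
    as [HA [HB [HC [HD [HF HH]]]]].
  - intros x y; pose proof (Hquad x y) as E; rewrite Hterm in E.
    unfold quadratic in *; lra.
  - repeat split; lra.
Qed.

Theorem lemma4p4
  (T a b Gamma sigma : R) (hT : 0 < T) (hsigma : sigma <> 0)
  (J : R -> R -> R -> R)
  (hJ : solves_equilibrium_PDE T a b Gamma sigma J)
  (A B C D F H : R -> R)
  (A' B' C' D' F' H' : R -> R)
  (hA : time_derivative T A A') (hB : time_derivative T B B')
  (hC : time_derivative T C C') (hD : time_derivative T D D')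
  (hF : time_derivative T F F') (hH : time_derivative T H H')
  (hquad : forall t x y, time_domain T t ->
     J t x y = A t * x ^ 2 + B t * y ^ 2 + C t * x * y
               + D t * x + F t * y + H t) :
  (forall t x, time_domain T t ->
     eq_control b J t x = - b * (2 * A t + C t) * x) /\
  ((forall t, time_domain T t ->
      A' t + 2 * a * A t - 2 * b ^ 2 * A t * (2 * A t + C t)
      + / 2 * b ^ 2 * (2 * A t + C t) ^ 2 = 0) /\
   A T = Gamma / 2) /\
  ((forall t, time_domain T t ->
      C' t + a * C t - b ^ 2 * C t * (2 * A t + C t) = 0) /\
   C T = - Gamma) /\
  ((forall t, time_domain T t ->
      H' t - / 2 * b ^ 2 * (D t) ^ 2 + sigma ^ 2 * A t = 0) /\
   H T = 0) /\
  (forall t, time_domain T t -> B t = Gamma / 2 /\ D t = 0 /\ F t = 0).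
Proof.
  pose proof (equilibrium_coefficient_equations T a b Gamma sigma J
    _ _ _ _ _ _ _ _ _ _ _ _ hT hJ hA hB hC hD hF hH hquad) as Hcoef.
  assert (HTT : time_domain T T) by (unfold time_domain; lra).
  destruct hJ as [_ [_ hterm]].
  destruct (terminal_coefficients T Gamma J _ _ _ _ _ _ hterm
    (fun x y => hquad T x y HTT)) as [HA [HB [HC [HD [HF HH]]]]].
  assert (D0 : forall t, time_domain T t -> D t = 0).
  { destruct (time_derivative_bounded_below T
      (fun t => 2 * b ^ 2 * A t - a) (fun t => 2 * b ^ 2 * A' t - 0))
      as [m Hm]; [lra | |].
    - intros t Ht.
      exact (Dminus _ _ _ _ _ _ (Dmult_const _ _ _ _ (2 * b ^ 2) (hA t Ht))
               (Dconst _ a t)).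
    - apply (linear_ode_backward_unique T m (fun t => 2 * b ^ 2 * A t - a) D D');
        [exact hD | | exact Hm | exact HD].
      intros t Ht; destruct (Hcoef t Ht) as [_ [_ [_ [E _]]]]; lra. }
  split; [|split; [|split; [|split]]].
  - intros t x Ht.
    rewrite (eq_control_quadratic J t _ _ _ _ _ _ (fun x y => hquad t x y Ht)).
    rewrite (D0 t Ht); ring.
  - split; [intros t Ht; apply (Hcoef t Ht) | exact HA].
  - split; [intros t Ht; apply (Hcoef t Ht) | exact HC].
  - split; [intros t Ht; apply (Hcoef t Ht) | exact HH].
  - intros t Ht; split; [|split; [exact (D0 t Ht)|]].
    + apply (zero_time_derivative_constant T _ B B'); auto.
      intros s Hs; apply (Hcoef s Hs).
    + apply (zero_time_derivative_constant T _ F F'); auto.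
      intros s Hs; destruct (Hcoef s Hs) as [_ [_ [_ [_ [E _]]]]].
      rewrite (D0 s Hs) in E; lra.
Qed.
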